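(* Let $m\ge 0$, $\hbar>0$, $c>0$. Consider a wave equation $a^{\mu\nu}\partial_\mu\partial_\nu\Psi+b^\mu\partial_\mu\Psi+f\Psi=0$ that is Lorentz covariant, in the sense defined in the context, with boost factors $g_{\mathbf v}$. Assume that, in accordance with de Broglie's hypothesis ($E=\hbar\omega$, $\mathbf p=\hbar\mathbf k$) and the Einstein energy-momentum relation ($E^2=m^2c^4+p^2c^2$), every plane wave $e^{i(\mathbf k\cdot\mathbf r-\omega t)}$ with $\mathbf k\in\mathbb{R}^3$, $\omega\in\mathbb{R}$, $\hbar^2\omega^2=m^2c^4+c^2\hbar^2|\mathbf k|^2$ is a solution. Then, up to an overall nonzero constant factor, the equation is the Klein-Gordon equation $$\partial_\mu\partial^\mu\Psi+\frac{m^2c^2}{\hbar^2}\Psi=0,$$ and every boost factor $g_{\mathbf v}$ is constant, i.e. up to an overall constant the wave function is a strict scalar, $\Psi(x)=\Psi'(x')$, under every Lorentz boost.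
   Context: Notation: $x=(x^0,x^1,x^2,x^3)=(ct,\mathbf r)$, $\partial_\mu=\partial/\partial x^\mu$, metric $\mathrm{diag}(1,-1,-1,-1)$, so $\partial_\mu\partial^\mu=\frac{1}{c^2}\partial_t^2-\nabla^2$; repeated indices are summed. Wave equation: a homogeneous linear partial differential equation of order at most two of the form $L\Psi:=a^{\mu\nu}\partial_\mu\partial_\nu\Psi+b^\mu\partial_\mu\Psi+f\Psi=0$ for a complex-valued function $\Psi(x)$, with constant complex coefficients $a^{\mu\nu},b^\mu$ and an arbitrary function $f(x)$, which actually involves time derivatives (after combining $a^{\mu\nu}$ and $a^{\nu\mu}$). Frames: a rotation relates $S$ and $S'$ by $\mathbf r'=M\mathbf r$, $t'=t$, $M\in SO(3)$. A Lorentz boost with velocity $\mathbf v$, $|\mathbf v|=v<c$, along the $x^1$-axis is $x^0=\gamma(x^{0'}+\beta x^{1'})$, $x^1=\gamma(x^{1'}+\beta x^{0'})$, $x^2=x^{2'}$, $x^3=x^{3'}$ with $\beta=v/c$, $\gamma=1/\sqrt{1-\beta^2}$, and analogously (by conjugation with a rotation) for any direction of $\mathbf v$. The function $f$ is a strict scalar: $f'(x')=f(x)$. Under rotations wave functions transform as $\Psi(x)=\Psi'(x')$; under a boost with velocity $\mathbf v$ as $\Psi(x)=g_{\mathbf v}(x')\Psi'(x')$ with $g_{\mathbf v}$ a smooth, nowhere vanishing complex-valued function. Lorentz covariance: for every rotation and every Lorentz boost, substituting the transformation law into $L\Psi$ and expressing everything in primed variables gives, for every smooth $\Psi'$, a nowhere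 vanishing function (independent of $\Psi'$) times $a^{\mu\nu}\partial_{\mu'}\partial_{\nu'}\Psi'+b^\mu\partial_{\mu'}\Psi'+f'\Psi'$, with the same constants $a^{\mu\nu},b^\mu$. *)

(* Defs.v *)
From HB Require Import structures.
From mathcomp Require Import all_boot all_order all_algebra.
From mathcomp Require Export complex.
From mathcomp Require Import all_classical all_reals all_analysis.

Set Implicit Arguments.
Unset Strict Implicit.
Unset Printing Implicit Defensive.

Import Order.TTheory GRing.Theory Num.Theory.
Import numFieldNormedType.Exports.

Local Open Scope ring_scope.
Local Open Scope complex_scope.

Section Defs.
Variable R : realType.

(* Events are columns (x^0, x^1, x^2, x^3) with x^0 = c t; index [ord0] is the
   time component and [lift ord0 i], for i : 'I_3, are the space components.
   R[i] carries no normed-module structure over R, hence differentiation of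
   complex-valued functions is done on real and imaginary parts. *)
Definition partial (mu : 'I_4) (F : 'cV[R]_4 -> R[i]) (x : 'cV[R]_4) : R[i] :=
  'D_(delta_mx mu ord0) (fun y => complex.Re (F y)) x
  +i* 'D_(delta_mx mu ord0) (fun y => complex.Im (F y)) x.

Definition cdifferentiable (F : 'cV[R]_4 -> R[i]) : Prop :=
  forall x, differentiable (fun y => complex.Re (F y)) x
         /\ differentiable (fun y => complex.Im (F y)) x.

(* C^oo: all iterated partial derivatives, including F itself ([s = [::]]), are
   (Frechet) differentiable everywhere. *)
Definition smooth (F : 'cV[R]_4 -> R[i]) : Prop :=
  forall s : seq 'I_4, cdifferentiable (foldr partial F s).

Definition wave_op (a : 'M[R[i]]_4) (b : 'cV[R[i]]_4) (f : 'cV[R]_4 -> R[i])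
    (Psi : 'cV[R]_4 -> R[i]) (x : 'cV[R]_4) : R[i] :=
  \sum_(mu < 4) \sum_(nu < 4) a mu nu * partial mu (partial nu Psi) x
  + \sum_(mu < 4) b mu ord0 * partial mu Psi x + f x * Psi x.

(* For nu = 0 the first alternative amounts to a^{00} <> 0. *)
Definition involves_time_derivatives (a : 'M[R[i]]_4) (b : 'cV[R[i]]_4) : Prop :=
  (exists nu : 'I_4, a ord0 nu + a nu ord0 != 0) \/ b ord0 ord0 != 0.

(* [`|v|] would be the sup norm on columns. *)
Definition enorm (v : 'cV[R]_3) : R := Num.sqrt (\sum_(i < 3) v i ord0 ^+ 2).

Definition SO3 (M : 'M[R]_3) : Prop := M^T *m M = 1%:M /\ \det M = 1.

Definition rot4 (M : 'M[R]_3) : 'M[R]_4 := lift0_mx M.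

Definition boost_x1 (beta : R) : 'M[R]_4 :=
  let gamma := (Num.sqrt (1 - beta ^+ 2))^-1 in
  \matrix_(i < 4, j < 4) nth 0 (nth [::]
    [:: [:: gamma;        gamma * beta; 0; 0];
        [:: gamma * beta; gamma;        0; 0];
        [:: 0;            0;            1; 0];
        [:: 0;            0;            0; 1]] i) j.

(* [B] is the matrix of x = B x' for the boost with velocity v: the boost along
   x^1 with the same speed, conjugated with a rotation [M] sending the
   x^1-direction to that of v. *)
Definition is_boost (c : R) (v : 'cV[R]_3) (B : 'M[R]_4) : Prop :=
  exists M : 'M[R]_3, [/\ SO3 M, v = enorm v *: col ord0 M
    & B = rot4 M *m boost_x1 (enorm v / c) *m invmx (rot4 M)].

(* Covariance under x = T x', Psi(x) = g(x') Psi'(x'), f'(x') = f(x). *)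
Definition covariant_under (a : 'M[R[i]]_4) (b : 'cV[R[i]]_4)
    (f : 'cV[R]_4 -> R[i]) (T : 'M[R]_4) (g : 'cV[R]_4 -> R[i]) : Prop :=
  exists h : 'cV[R]_4 -> R[i],
    (forall x', h x' != 0) /\
    (forall Psi' : 'cV[R]_4 -> R[i], smooth Psi' -> forall x' : 'cV[R]_4,
      wave_op a b f
        (fun x => g (invmx T *m x) * Psi' (invmx T *m x)) (T *m x')
      = h x' * wave_op a b (fun y' => f (T *m y')) Psi' x').

(* A rotation is x' = rot4 M x, whence the inverse. *)
Definition lorentz_covariant (c : R) (a : 'M[R[i]]_4) (b : 'cV[R[i]]_4)
    (f : 'cV[R]_4 -> R[i]) (g : 'cV[R]_3 -> 'cV[R]_4 -> R[i]) : Prop :=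
  (forall M : 'M[R]_3, SO3 M ->
     covariant_under a b f (invmx (rot4 M)) (fun=> 1)) /\
  (forall v : 'cV[R]_3, enorm v < c ->
     [/\ smooth (g v), forall x', g v x' != 0
       & forall B : 'M[R]_4, is_boost c v B -> covariant_under a b f B (g v)]).

Definition plane_wave (c : R) (k : 'cV[R]_3) (omega : R) (x : 'cV[R]_4) : R[i] :=
  let t := x ord0 ord0 / c in
  let theta := \sum_(i < 3) k i ord0 * x (lift ord0 i) ord0 - omega * t in
  cos theta +i* sin theta.

Definition minkowski : 'M[R]_4 :=
  diag_mx (\row_(mu < 4) if mu == ord0 then 1 else -1).

Definition dalembertian (Psi : 'cV[R]_4 -> R[i]) (x : 'cV[R]_4) : R[i] :=
  \sum_(mu < 4) \sum_(nu < 4)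
    (minkowski mu nu)%:C * partial mu (partial nu Psi) x.

Definition klein_gordon_op (m c hbar : R) (Psi : 'cV[R]_4 -> R[i])
    (x : 'cV[R]_4) : R[i] :=
  dalembertian Psi x + (m ^+ 2 * c ^+ 2 / hbar ^+ 2)%:C * Psi x.

End Defs.

(* Main.v *)
(* On a plane wave with covector K the equation reads
   f(x) = a^{mu nu} K_mu K_nu - i b^mu K_mu. Replacing K by - K, which stays on
   the mass shell, gives b K = 0 on the shell, hence b = 0; evaluating the
   quadratic form at (s, t e_i + r e_j) then forces the symmetric part of a to
   be a^{00} times the Minkowski metric and f = a^{00} (mc/hbar)^2. The
   antisymmetric part of a acts trivially by symmetry of second derivatives.
   For the boost factors, covariance is tested on the functions 1 and x^mu:
   since b = 0, comparing the two results leaves only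
   d_mu g = 0. *)
Require Import Defs.
From HB Require Import structures.
From mathcomp Require Import all_boot all_order all_algebra.
From mathcomp Require Import complex.
From mathcomp Require Import all_classical all_reals all_analysis.
From mathcomp Require Import ring lra.

Set Implicit Arguments.
Unset Strict Implicit.
Unset Printing Implicit Defensive.

Import Order.TTheory GRing.Theory Num.Theory.
Import numFieldNormedType.Exports.

Local Open Scope ring_scope.
Local Open Scope complex_scope.

(** * Symmetry of second derivatives *)

Section DirectionalDerivatives.
Variables (R : realType) (V : normedModType R).
Implicit Types (F : V -> R) (u v x : V) (e : R).

(** Both difference quotients are the same function of [h], so derivability and value carry over
    together. *)
Lemma is_derive_along F u x (t : R) : differentiable F (x + t *: u) ->
  is_derive t 1 (fun s : R => F (x + s *: u)) ('D_u F (x + t *: u)).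
Proof.
move=> /(@diff_derivable _ _ _ F _ u) dF.
have E : (fun h : R => h^-1 *: (((fun s : R => F (x + s *: u)) \o shift t)
    (h *: 1) - F (x + t *: u)))
  = (fun h : R => h^-1 *: ((F \o shift (x + t *: u)) (h *: u)
                           - F (x + t *: u))).
  apply/funext => h /=; congr (_ *: (F _ - _)).
  by rewrite [h *: 1]mulr1 scalerDl addrCA.
by split; [rewrite /derivable E | rewrite /derive E].
Qed.

Lemma differentiable_bound F x e : differentiable F x -> 0 < e ->
  exists2 d : R, 0 < d & forall w, `|w| < d ->
    `|F (x + w) - F x - 'D_w F x| <= e * `|w|.
Proof.
move=> dF e0; have /diff_locally /eqaddoP /(_ e e0) := dF.
rewrite near_simpl => /nbhs_ballP[d d0 H]; exists d => // w wd.
have /H : ball (0 : V) d w by rewrite -ball_normE /= sub0r normrN.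
by rewrite deriveE //= !fctE /= [w + x]addrC opprD addrA.
Qed.

Lemma deriveB_dir F x v w : differentiable F x ->
  'D_(v - w) F x = 'D_v F x - 'D_w F x.
Proof. by move=> dF; rewrite !deriveE // linearB. Qed.

Lemma deriveZ_dir F x h v : differentiable F x ->
  'D_(h *: v) F x = h * 'D_v F x.
Proof. by move=> dF; rewrite !deriveE // linearZ. Qed.

(* Mean value theorem in the direction [u], then Frechet differentiability of
   ['D_u F] at [x]. *)
Lemma second_difference F u v x e :
  (forall y, differentiable F y) -> differentiable ('D_u F) x -> 0 < e ->
  exists2 d : R, 0 < d & forall h : R, 0 < h < d ->
    `|F (x + h *: v + h *: u) - F (x + h *: u) - (F (x + h *: v) - F x)
      - h ^+ 2 * 'D_v ('D_u F) x| <= e * h ^+ 2.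
Proof.
move=> dF dP e0; set P : V -> R := 'D_u F.
(* [h * N] bounds both displacements [w1] and [w2]; the summand 1 keeps [N] positive when [u] and
   [v] vanish. *)
pose N := `|u| + `|v| + 1.
have N0 : 0 < N by rewrite ltr_wpDl // addr_ge0.
(* Two remainders of size at most [e' * (h * N)] add up to [e * h]; the mean value theorem supplies
   the other factor [h]. *)
pose e' := e / (2 * N).
have e'0 : 0 < e' by rewrite divr_gt0 // mulr_gt0.
have [d d0 H] := differentiable_bound dP e'0.
exists (d / N); first by rewrite divr_gt0.
move=> h /andP[h0 hd].
(* The increment of [phi] from 0 to [h] is the second difference. *)
pose phi (s : R) : R := F (x + h *: v + s *: u) - F (x + s *: u).
have dphi s :
    is_derive s (1 : R) phi (P (x + h *: v + s *: u) - P (x + s *: u)).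
  have d1 := is_derive_along (dF (x + h *: v + s *: u)).
  have d2 := is_derive_along (dF (x + s *: u)).
  exact: is_deriveB.
have [|xi xih] := MVT h0 (fun s _ => dphi s).
  apply/continuous_subspaceT => s.
  by apply/differentiable_continuous/derivable1_diffP; case: (dphi s).
rewrite /phi !scale0r !addr0 subr0 => ->.
have /andP[xi0 xi_h] : 0 < xi < h by move: xih; rewrite in_itv.
set w1 := h *: v + xi *: u; set w2 := xi *: u.
have normh y : `|h *: y| = h * `|y| by rewrite normrZ gtr0_norm.
have xiu : xi * `|u| <= h * `|u| by rewrite ler_wpM2r // ltW.
have hv : 0 <= h * `|v| by rewrite mulr_ge0 // ltW.
have w2le : `|w2| <= h * N by rewrite /w2 normrZ gtr0_norm // /N; lra.
have w1le : `|w1| <= h * N.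
  rewrite (le_trans (ler_normD _ _)) // normh normrZ gtr0_norm //.
  by rewrite /N; lra.
have hNd : h * N < d by rewrite -ltr_pdivlMr.
have w21 : 'D_w1 P x - 'D_w2 P x = h * 'D_v P x.
  by rewrite -deriveB_dir // /w1 /w2 addrK deriveZ_dir.
have := H _ (le_lt_trans w1le hNd); have := H _ (le_lt_trans w2le hNd).
rewrite /w1 /w2 addrA -/w1 -/w2.
set p1 := P (_ + _ + _); set p2 := P (_ + _); move=> B2 B1.
(* Both values of [P] are expanded at the same point [x]: [P x] cancels, and by [w21] the linear
   parts leave [h * 'D_v P x]. *)
have -> : (p1 - p2) * h - h ^+ 2 * 'D_v P x
   = h * ((p1 - P x - 'D_w1 P x) - (p2 - P x - 'D_w2 P x)).
  rewrite expr2 -mulrA -w21.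
  by move: (P x) ('D_w1 P x) ('D_w2 P x) => q r1 r2; ring.
rewrite normrM gtr0_norm // expr2 mulrCA ler_pM2l //.
rewrite (le_trans (ler_normB _ _)) // (le_trans (lerD B1 B2)) //.
have ee : e = e' * N + e' * N by rewrite /e'; field; rewrite gt_eqF.
clearbody e'; rewrite ee mulrDl -!mulrA [N * h]mulrC.
by rewrite lerD // ler_pM2l.
Qed.

(** The second difference is symmetric in [u] and [v], and [h ^+ 2] times either mixed derivative
    lies within [e / 2 * h ^+ 2] of it. Hence the two differ by at most [e], for every positive
    [e]. *)
Lemma derive_swap F u v x :
  (forall y, differentiable F y) ->
  differentiable ('D_u F) x -> differentiable ('D_v F) x ->
  'D_v ('D_u F) x = 'D_u ('D_v F) x.
Proof.
move=> dF du dv; apply/eqP; rewrite -subr_eq0 -normr_le0.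
apply/ler_addgt0Pr => e e0; rewrite add0r.
have e20 : 0 < e / 2 by rewrite divr_gt0.
have [d1 d10 H1] := second_difference v dF du e20.
have [d2 d20 H2] := second_difference u dF dv e20.
pose h := Num.min d1 d2 / 2.
have m0 : 0 < Num.min d1 d2 by rewrite lt_min d10.
have h0 : 0 < h by rewrite divr_gt0.
have hm : h < Num.min d1 d2 by rewrite /h ltr_pdivrMr // mulr_natr mulr2n ltrDl.
have /H1 B1 : 0 < h < d1 by rewrite h0 (lt_le_trans hm) // ge_min lexx.
have /H2 B2 : 0 < h < d2 by rewrite h0 (lt_le_trans hm) // ge_min lexx orbT.
move: B1 B2; rewrite [x + h *: u + h *: v]addrAC.
set A := F (_ + _ + _); set B := F (_ + _ *: u); set C := F (_ + _ *: v).
set p := 'D_v _ _; set q := 'D_u _ _ => B1 B2.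
rewrite -(@ler_pM2l _ (h ^+ 2)) ?exprn_gt0 //.
rewrite -[X in X * _]gtr0_norm ?exprn_gt0 // -normrM.
have -> : h ^+ 2 * (p - q) = (A - C - (B - F x) - h ^+ 2 * q)
                       - (A - B - (C - F x) - h ^+ 2 * p) by ring.
rewrite (le_trans (ler_normB _ _)) // (le_trans (lerD B2 B1)) //.
by rewrite -mulrDl -splitr mulrC.
Qed.

(** On the line through [x] and [y] the function has zero derivative in one real variable. *)
Lemma derive0_constant F :
  (forall x, differentiable F x) -> (forall x v, 'D_v F x = 0) ->
  forall x y, F x = F y.
Proof.
move=> dF F0 x y.
pose phi (t : R) : R := F (x + t *: (y - x)).
have dphi t : is_derive (t : R) 1 phi 0.
  by rewrite -(F0 (x + t *: (y - x)) (y - x)); apply: is_derive_along.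
have := is_derive_0_is_cst 0 1 dphi.
by rewrite /phi scale0r addr0 scale1r addrC subrK.
Qed.

End DirectionalDerivatives.

(** * Partial derivatives of complex-valued functions *)

Section PartialDerivatives.
Variable R : realType.
Implicit Types (F G : 'cV[R]_4 -> R[i]) (x y : 'cV[R]_4) (f : 'cV[R]_4 -> R).
Implicit Types (mu nu rho : 'I_4).

Local Notation e_ mu := (delta_mx mu ord0 : 'cV[R]_4).

Lemma smooth_cdifferentiable F : smooth F -> cdifferentiable F.
Proof. by move/(_ [::]). Qed.

Lemma smooth_cdifferentiable_partial F mu :
  smooth F -> cdifferentiable (partial mu F).
Proof. by move/(_ [:: mu]). Qed.

Lemma partial_partial F mu nu x : partial mu (partial nu F) x =
  'D_(e_ mu) ('D_(e_ nu) (fun y => complex.Re (F y))) x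
  +i* 'D_(e_ mu) ('D_(e_ nu) (fun y => complex.Im (F y))) x.
Proof. by []. Qed.

Lemma partial_swap F mu nu x : smooth F ->
  partial mu (partial nu F) x = partial nu (partial mu F) x.
Proof.
move=> sF.
have dF := smooth_cdifferentiable sF.
have [dRe_mu dIm_mu] := smooth_cdifferentiable_partial mu sF x.
have [dRe_nu dIm_nu] := smooth_cdifferentiable_partial nu sF x.
rewrite !partial_partial.
rewrite (derive_swap (fun y => proj1 (dF y)) dRe_nu dRe_mu).
by rewrite (derive_swap (fun y => proj2 (dF y)) dIm_nu dIm_mu).
Qed.

Lemma col_sum_delta (v : 'cV[R]_4) : v = \sum_mu v mu ord0 *: e_ mu.
Proof.
apply/matrixP => i j; rewrite ord1 summxE (bigD1 i) //= big1 => [|k ki].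
  by rewrite !mxE !eqxx mulr1 addr0.
by rewrite !mxE eq_sym (negbTE ki) mulr0.
Qed.

Lemma derive_sum_delta f x v : differentiable f x ->
  'D_v f x = \sum_mu v mu ord0 * 'D_(e_ mu) f x.
Proof.
move=> df; rewrite deriveE // {1}(col_sum_delta v) linear_sum /=.
by apply: eq_bigr => mu _; rewrite linearZ /= deriveE.
Qed.

Lemma cdifferentiable_partial0_constant F :
  cdifferentiable F -> (forall mu x, partial mu F x = 0) ->
  forall x y, F x = F y.
Proof.
move=> dF F0 x y.
have ReF : complex.Re (F x) = complex.Re (F y).
  apply: (derive0_constant (F := fun z => complex.Re (F z))) => [z|z v].
    by case: (dF z).
  rewrite derive_sum_delta; last by case: (dF z).
  by rewrite big1 // => mu _; case: (F0 mu z) => -> _; rewrite mulr0.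
have ImF : complex.Im (F x) = complex.Im (F y).
  apply: (derive0_constant (F := fun z => complex.Im (F z))) => [z|z v].
    by case: (dF z).
  rewrite derive_sum_delta; last by case: (dF z).
  by rewrite big1 // => mu _; case: (F0 mu z) => _ ->; rewrite mulr0.
by move: ReF ImF; case: (F x) => ? ?; case: (F y) => ? ? /= -> ->.
Qed.

(** In coordinates the map is a sum of coordinate functions times fixed columns of [A]. *)
Lemma differentiable_mulmx (A : 'M[R]_4) x :
  differentiable (mulmx A : 'cV[R]_4 -> 'cV[R]_4) x.
Proof.
have -> : (mulmx A : 'cV[R]_4 -> 'cV[R]_4)
        = \sum_nu (fun y : 'cV[R]_4 => y nu ord0 *: col nu A).
  apply/funext => y; rewrite fct_sumE {1}(col_sum_delta y) mulmx_sumr.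
  by apply: eq_bigr => nu _; rewrite -scalemxAr -colE.
apply: differentiable_sum => nu; apply: differentiableZl.
exact: differentiable_coord.
Qed.

Lemma differentiable_comp_mulmx f (A : 'M[R]_4) x :
  differentiable f (A *m x) -> differentiable (fun y => f (A *m y)) x.
Proof.
by move=> df; apply: differentiable_comp (differentiable_mulmx A x) df.
Qed.

(** By linearity of [A] the two difference quotients agree term by term, so the defining limits are
    the same. *)
Lemma derive_comp_mulmx f (A : 'M[R]_4) v x :
  'D_v (fun y => f (A *m y)) x = 'D_(A *m v) f (A *m x).
Proof.
have E : (fun h : R => h^-1 *: (((fun y => f (A *m y)) \o shift x) (h *: v)
                                - f (A *m x)))
       = (fun h : R => h^-1 *: ((f \o shift (A *m x)) (h *: (A *m v))
                                - f (A *m x))).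
  by apply/funext => h /=; rewrite mulmxDr -scalemxAr.
by rewrite /derive E.
Qed.

Lemma cdifferentiable_comp_mulmx F (A : 'M[R]_4) :
  cdifferentiable F -> cdifferentiable (fun y => F (A *m y)).
Proof.
move=> dF x; case: (dF (A *m x)) => dRe dIm; split.
  exact: (differentiable_comp_mulmx (f := fun y => complex.Re (F y))).
exact: (differentiable_comp_mulmx (f := fun y => complex.Im (F y))).
Qed.

(** Real constant coefficients are what the chain rule produces under a linear substitution. *)
Lemma cdifferentiable_sum n (H : 'I_n -> 'cV[R]_4 -> R[i]) (c : 'I_n -> R) :
  (forall k, cdifferentiable (H k)) ->
  cdifferentiable (fun y => \sum_k (c k)%:C * H k y).
Proof.
have ReIm_sum y : (\sum_k (c k)%:C * H k y)
    = (\sum_k c k *: complex.Re (H k y)) +i* (\sum_k c k *: complex.Im (H k y)).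
  elim/big_rec3: _ => [|k u1 u2 u3 _ ->] //.
  by case: (H k y) => p q /=; simpc.
move=> dH x; split.
  have -> : (fun y => complex.Re (\sum_k (c k)%:C * H k y))
          = \sum_k (fun y => c k *: complex.Re (H k y)).
    by apply/funext => y; rewrite ReIm_sum fct_sumE.
  by apply: differentiable_sum => k; apply: differentiableZ; case: (dH k x).
have -> : (fun y => complex.Im (\sum_k (c k)%:C * H k y))
        = \sum_k (fun y => c k *: complex.Im (H k y)).
  by apply/funext => y; rewrite ReIm_sum fct_sumE.
by apply: differentiable_sum => k; apply: differentiableZ; case: (dH k x).
Qed.

Lemma partial_comp_mulmx F (A : 'M[R]_4) mu x : cdifferentiable F ->
  partial mu (fun y => F (A *m y)) x
  = \sum_nu (A nu mu)%:C * partial nu F (A *m x).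
Proof.
move=> dF; have [dRe dIm] := dF (A *m x).
have coef nu : (A *m e_ mu) nu ord0 = A nu mu by rewrite -colE mxE.
have sumE (p q : 'I_4 -> R) : \sum_nu (A nu mu)%:C * (p nu +i* q nu)
    = (\sum_nu A nu mu * p nu) +i* (\sum_nu A nu mu * q nu).
  elim/big_rec3: _ => [|k u1 u2 u3 _ ->] //.
  by simpc.
rewrite [RHS]sumE /partial.
rewrite (derive_comp_mulmx (fun y => complex.Re (F y))).
rewrite (derive_comp_mulmx (fun y => complex.Im (F y))).
rewrite (derive_sum_delta _ dRe) (derive_sum_delta _ dIm).
by congr Complex; apply: eq_bigr => nu _; rewrite coef.
Qed.

Lemma cdifferentiable_partial_comp_mulmx F (A : 'M[R]_4) mu : smooth F ->
  cdifferentiable (partial mu (fun y => F (A *m y))).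
Proof.
move=> sF.
have -> : partial mu (fun y => F (A *m y))
        = (fun y => \sum_nu (A nu mu)%:C * partial nu F (A *m y)).
  apply/funext => y; apply: partial_comp_mulmx.
  exact: smooth_cdifferentiable.
apply: (cdifferentiable_sum (H := fun nu y => partial nu F (A *m y))) => nu.
exact/cdifferentiable_comp_mulmx/smooth_cdifferentiable_partial.
Qed.

Lemma Re_scale (p q : R) F : (fun y => complex.Re ((p +i* q) * F y))
  = (p \*: (fun y => complex.Re (F y))) - (q \*: (fun y => complex.Im (F y))).
Proof.
apply/funext => y.
by change (complex.Re ((p +i* q) * F y)
           = p * complex.Re (F y) - q * complex.Im (F y)); case: (F y).
Qed.

Lemma Im_scale (p q : R) F : (fun y => complex.Im ((p +i* q) * F y))
  = (p \*: (fun y => complex.Im (F y))) + (q \*: (fun y => complex.Re (F y))).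
Proof.
apply/funext => y.
by change (complex.Im ((p +i* q) * F y)
           = p * complex.Im (F y) + q * complex.Re (F y)); case: (F y).
Qed.

Lemma cdifferentiableZ (z : R[i]) F :
  cdifferentiable F -> cdifferentiable (fun y => z * F y).
Proof.
case: z => p q dF x; have [dRe dIm] := dF x; rewrite Re_scale Im_scale; split.
  by apply: differentiableB; apply: differentiableZ.
by apply: differentiableD; apply: differentiableZ.
Qed.

Lemma partialZ (z : R[i]) F mu x : cdifferentiable F ->
  partial mu (fun y => z * F y) x = z * partial mu F x.
Proof.
case: z => p q dF; have [dRe dIm] := dF x.
have dRe' := @diff_derivable _ _ _ _ _ (e_ mu) dRe.
have dIm' := @diff_derivable _ _ _ _ _ (e_ mu) dIm.
rewrite /partial Re_scale Im_scale.
rewrite (deriveB (derivableZ (k := p) dRe') (derivableZ (k := q) dIm')).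
rewrite (deriveD (derivableZ (k := p) dIm') (derivableZ (k := q) dRe')).
by rewrite !(deriveZ _ dRe') !(deriveZ _ dIm').
Qed.

Lemma partialD F G mu x : cdifferentiable F -> cdifferentiable G ->
  partial mu (fun y => F y + G y) x = partial mu F x + partial mu G x.
Proof.
move=> dF dG; have [dReF dImF] := dF x; have [dReG dImG] := dG x.
rewrite /partial.
have -> : (fun y => complex.Re (F y + G y))
  = (fun y => complex.Re (F y)) + (fun y => complex.Re (G y)).
  by apply/funext => y; rewrite fctE; case: (F y) => ? ?; case: (G y).
have -> : (fun y => complex.Im (F y + G y))
  = (fun y => complex.Im (F y)) + (fun y => complex.Im (G y)).
  by apply/funext => y; rewrite fctE; case: (F y) => ? ?; case: (G y).
by rewrite !deriveD //; apply: diff_derivable.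
Qed.

End PartialDerivatives.

(** * Products with real functions, affine functions, and exponentials of real phases *)

Section ExplicitFunctions.
Variable R : realType.
Implicit Types (F G : 'cV[R]_4 -> R[i]) (x y : 'cV[R]_4) (f : 'cV[R]_4 -> R).
Implicit Types (mu nu rho : 'I_4) (T : 'M[R]_4).

Local Notation e_ mu := (delta_mx mu ord0 : 'cV[R]_4).

Lemma cdifferentiableMr G f :
  cdifferentiable G -> (forall x, differentiable f x) ->
  cdifferentiable (fun y => G y * (f y)%:C).
Proof.
move=> dG df x; have [dRe dIm] := dG x; split.
  have -> : (fun y => complex.Re (G y * (f y)%:C))
          = (fun y => complex.Re (G y)) * f.
    apply/funext => y.
    change (complex.Re (G y * (f y)%:C) = complex.Re (G y) * f y).
    by case: (G y) => p q /=; rewrite mulr0 subr0.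
  exact: differentiableM.
have -> : (fun y => complex.Im (G y * (f y)%:C))
        = (fun y => complex.Im (G y)) * f.
  apply/funext => y.
  change (complex.Im (G y * (f y)%:C) = complex.Im (G y) * f y).
  by case: (G y) => p q /=; rewrite mulr0 add0r.
exact: differentiableM.
Qed.

Lemma partialMr G f mu x :
  cdifferentiable G -> (forall x, differentiable f x) ->
  partial mu (fun y => G y * (f y)%:C) x
  = partial mu G x * (f x)%:C + G x * ('D_(e_ mu) f x)%:C.
Proof.
move=> dG df; have [dRe dIm] := dG x; rewrite /partial.
have -> : (fun y => complex.Re (G y * (f y)%:C))
        = (fun y => complex.Re (G y)) * f.
  apply/funext => y.
  change (complex.Re (G y * (f y)%:C) = complex.Re (G y) * f y).
  by case: (G y) => p q /=; rewrite mulr0 subr0.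
have -> : (fun y => complex.Im (G y * (f y)%:C))
        = (fun y => complex.Im (G y)) * f.
  apply/funext => y.
  change (complex.Im (G y * (f y)%:C) = complex.Im (G y) * f y).
  by case: (G y) => p q /=; rewrite mulr0 add0r.
have df' := @diff_derivable _ _ _ _ _ (e_ mu) (df x).
rewrite (deriveM (diff_derivable dRe) df') (deriveM (diff_derivable dIm) df').
have key (t d1 d2 d3 p q : R) : ((p * d1 + t * d2) +i* (q * d1 + t * d3))
    = (d2 +i* d3) * t%:C + (p +i* q) * d1%:C :> R[i].
  by rewrite /real_complex_def; simpc; congr Complex; ring.
by case: (G x) => p q; exact: key.
Qed.

Lemma differentiable_coordD rho d x :
  differentiable (fun y : 'cV[R]_4 => y rho ord0 + d) x.
Proof.
apply: (differentiableD (f := fun y : 'cV[R]_4 => y rho ord0) (g := cst d)).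
  exact: differentiable_coord.
exact: differentiable_cst.
Qed.

Lemma derive_coordD rho d v x :
  'D_v (fun y : 'cV[R]_4 => y rho ord0 + d) x = v rho ord0.
Proof.
have dc := @diff_derivable _ _ _ _ _ v (differentiable_coord x rho ord0).
rewrite (deriveD dc (derivable_cst d x v)) derive_cst addr0.
(* The derivative of a coordinate is the coordinate of the derivative of the identity map. *)
have := derive_mx (M := @id 'cV[R]_4) (@derivable_id _ _ x v).
by rewrite derive_id => /matrixP/(_ rho ord0); rewrite mxE => <-.
Qed.

(** The test functions for covariance. With [T = 0] the family contains the constants, so it is
    closed under partial derivatives. *)
Definition affine rho T (d : R) y : R[i] := ((T *m y) rho ord0 + d)%:C.

Lemma partial_affine rho T d mu :
  partial mu (affine rho T d) = affine rho 0 (T rho mu).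
Proof.
apply/funext => x; rewrite /partial /affine mul0mx mxE add0r.
rewrite (derive_comp_mulmx (fun y => y rho ord0 + d)) derive_coordD.
by rewrite -colE mxE derive_cst.
Qed.

(** Induction on the list of derivatives: each one stays in the affine family, whose members are
    differentiable. *)
Lemma smooth_affine rho T d : smooth (affine rho T d).
Proof.
move=> s; suff [T' [d' ->]] : exists T' d',
    foldr (@partial R) (affine rho T d) s = affine rho T' d'.
  move=> x; split; last exact: differentiable_cst.
  exact/(differentiable_comp_mulmx (f := fun y => y rho ord0 + d'))
       /differentiable_coordD.
elim: s => [|mu s [T' [d' IH]]]; first by exists T, d.
by exists 0, (T' rho mu); rewrite /= IH partial_affine.
Qed.

Lemma derive_comp_real (h : R -> R) f v x :
  derivable h (f x) 1 -> differentiable f x ->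
  'D_v (fun y => h (f y)) x = 'D_v f x * 'D_1 h (f x).
Proof.
move=> dh df; have dh' := (derivable1_diffP _ _).1 dh.
rewrite !deriveE //; last exact: differentiable_comp.
rewrite (diff_comp df dh') /= [in LHS](deriv1E dh).
by rewrite derive1E deriveE.
Qed.

Definition expi (t : R) : R[i] := cos t +i* sin t.

Lemma expi_neq0 t : expi t != 0.
Proof.
apply/negP => /eqP[c0 s0]; have := cos2Dsin2 t.
by rewrite c0 s0 expr0n addr0 => /eqP; rewrite eq_sym oner_eq0.
Qed.

Lemma cdifferentiable_expi f : (forall x, differentiable f x) ->
  cdifferentiable (fun y => expi (f y)).
Proof.
move=> df x; split.
  apply: (@differentiable_comp _ _ _ _ f cos x (df x)).
  exact/derivable1_diffP/derivable_cos.
apply: (@differentiable_comp _ _ _ _ f sin x (df x)).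
exact/derivable1_diffP/derivable_sin.
Qed.

Lemma partial_expi f mu x : (forall x, differentiable f x) ->
  partial mu (fun y => expi (f y)) x
  = 'i%C * ('D_(e_ mu) f x)%:C * expi (f x).
Proof.
move=> df; rewrite /partial.
rewrite (derive_comp_real (h := cos) (e_ mu) (@derivable_cos R (f x)) (df x)).
rewrite (derive_comp_real (h := sin) (e_ mu) (@derivable_sin R (f x)) (df x)).
rewrite !derive_val /expi; move: ('D_(e_ mu) f x) => d.
by rewrite /real_complex_def; simpc; congr Complex; ring.
Qed.

End ExplicitFunctions.

(** * Plane waves and the mass shell *)

Section DispersionRelation.
Variable R : realType.
Implicit Types (a : 'M[R[i]]_4) (b : 'cV[R[i]]_4) (f : 'cV[R]_4 -> R[i]).
Implicit Types (K : 'I_4 -> R) (x y : 'cV[R]_4) (mu nu : 'I_4) (i j : 'I_3).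

Local Notation e_ mu := (delta_mx mu ord0 : 'cV[R]_4).

(** [K] is a covector, so no metric signs appear; a plane wave has time component [K ord0] equal to
    -omega/c. *)
Definition phase K y : R := \sum_mu K mu * y mu ord0.

(** All rows of the matrix equal [K], and the final [+ 0] gives the shape of [derive_coordD]; the
    phase thus inherits its derivatives from coordinates. *)
Lemma phaseE K y :
  phase K y = ((\matrix_(mu < 4, nu < 4) K nu) *m y) ord0 ord0 + 0.
Proof. by rewrite mxE addr0; apply: eq_bigr => mu _; rewrite mxE. Qed.

Lemma differentiable_phase K x : differentiable (phase K) x.
Proof.
rewrite (funext (phaseE K)).
exact/(differentiable_comp_mulmx (f := fun y => y ord0 ord0 + 0))
     /differentiable_coordD.
Qed.

Lemma derive_phase K mu x : 'D_(e_ mu) (phase K) x = K mu.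
Proof.
rewrite (funext (phaseE K)) (derive_comp_mulmx (fun y => y ord0 ord0 + 0)).
by rewrite derive_coordD -colE !mxE.
Qed.

(** The sign is chosen so that a plane wave with covector [K] solves the equation exactly when the
    symbol equals [f]. *)
Definition symbol a b K : R[i] :=
  \sum_mu \sum_nu a mu nu * (K mu)%:C * (K nu)%:C
  - 'i%C * \sum_mu b mu ord0 * (K mu)%:C.

Lemma wave_op_expi a b f K x :
  wave_op a b f (fun y => expi (phase K y)) x
  = (f x - symbol a b K) * expi (phase K x).
Proof.
have dE := cdifferentiable_expi (differentiable_phase K).
have d1 mu : partial mu (fun y => expi (phase K y))
           = (fun y => 'i%C * (K mu)%:C * expi (phase K y)).
  apply/funext => y; rewrite partial_expi ?derive_phase //.
  exact: differentiable_phase.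
have d2 mu nu : partial mu (partial nu (fun y => expi (phase K y))) x
              = - ((K mu)%:C * (K nu)%:C) * expi (phase K x).
  (* The sign is written as the square of ['i], after which the identity is polynomial with ['i]
     opaque. *)
  rewrite d1 partialZ // d1 -[-(_ * _)]mulN1r -sqr_i.
  by move: (expi _) (K mu)%:C (K nu)%:C 'i%C => E p q z; ring.
have -> : wave_op a b f (fun y => expi (phase K y)) x
  = - (\sum_mu \sum_nu a mu nu * (K mu)%:C * (K nu)%:C) * expi (phase K x)
    + 'i%C * (\sum_mu b mu ord0 * (K mu)%:C) * expi (phase K x)
    + f x * expi (phase K x).
  rewrite /wave_op; congr (_ + _ + _).
    rewrite mulNr mulr_suml -sumrN; apply: eq_bigr => mu _.
    rewrite mulr_suml -sumrN; apply: eq_bigr => nu _.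
    by rewrite d2 mulNr mulrN !mulrA.
  rewrite mulr_sumr mulr_suml; apply: eq_bigr => mu _.
  by rewrite d1 !mulrA [b _ _ * _]mulrC.
by rewrite /symbol; ring.
Qed.

End DispersionRelation.

(** * Coefficients determined by the mass shell *)

Section Shell.
Variables (R : realType) (a : 'M[R[i]]_4) (b : 'cV[R[i]]_4) (f0 : R[i]).
Variable kap : R.
(** In the application [kap] is mc/hbar and [f0] is the value of [f] at one chosen point. *)
Hypothesis shell : forall K : 'I_4 -> R,
  K ord0 ^+ 2 = kap ^+ 2 + \sum_(i < 3) K (lift ord0 i) ^+ 2 ->
  symbol a b K = f0.
Implicit Types (mu nu : 'I_4) (i j : 'I_3) (s t r : R).

(** The covector (s, t e_i + r e_j). Allowing [i = j] with [r = 0] lets one computation serve one or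
    two spatial directions; the condition [r * (i == j)%:R = 0] below excludes the cross term that
    would spoil the norm. *)
Definition covector i j s t r mu : R :=
  s * (mu == ord0)%:R + t * (mu == lift ord0 i)%:R + r * (mu == lift ord0 j)%:R.

Lemma sum_covector (F : 'I_4 -> R[i]) i j s t r :
  \sum_mu F mu * (covector i j s t r mu)%:C
  = s%:C * F ord0 + t%:C * F (lift ord0 i) + r%:C * F (lift ord0 j).
Proof.
have pick (z : R) nu : \sum_mu F mu * (z * (mu == nu)%:R)%:C = z%:C * F nu.
  rewrite (bigD1 nu) //= eqxx mulr1 big1 ?addr0 1?mulrC // => mu /negbTE ->.
  by rewrite mulr0 mulr0.
rewrite -!pick -!big_split; apply: eq_bigr => mu _ /=.
by rewrite -!mulrDr -!rmorphD.
Qed.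

Lemma covector_shell i j s t r : r * (i == j)%:R = 0 ->
  s ^+ 2 = kap ^+ 2 + t ^+ 2 + r ^+ 2 ->
  let K := covector i j s t r in
  K ord0 ^+ 2 = kap ^+ 2 + \sum_(i < 3) K (lift ord0 i) ^+ 2.
Proof.
move=> rij sE K; rewrite {1}/K /covector eqxx ![ord0 == lift _ _]eq_sym /=.
rewrite !mulr0 mulr1 !addr0 sE -addrA; congr (_ + _).
rewrite (bigD1 i) //= {1}/K /covector /= eqxx mulr0 mulr1 add0r.
rewrite (inj_eq (@lift_inj _ _)) rij addr0; congr (_ + _).
have [ij|ij] := eqVneq i j.
  move: rij; rewrite ij eqxx mulr1 => r0; rewrite r0 expr0n big1 //.
  move=> k /negbTE kj; rewrite /K /covector /= ij !(inj_eq (@lift_inj _ _)) kj.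
  by rewrite r0 !mul0r !mulr0 !addr0 expr0n.
rewrite (bigD1 j) ?[j == i]eq_sym //= big1 => [|k /andP[/negbTE ki /negbTE kj]].
  rewrite /K /covector /= !(inj_eq (@lift_inj _ _)) eqxx [j == i]eq_sym.
  by rewrite (negbTE ij) !mulr0 mulr1 !add0r addr0.
by rewrite /K /covector /= !(inj_eq (@lift_inj _ _)) ki kj !mulr0 !addr0 expr0n.
Qed.

(** Twice the symmetric part of [a], the only part that a quadratic form detects. *)
Local Notation A mu nu := (a mu nu + a nu mu).

(* Adding and subtracting the relations at [K] and [- K] separates the odd part
   [b] of the symbol from its even part [a]. *)
Lemma symbol_covector i j s t r : r * (i == j)%:R = 0 ->
  s ^+ 2 = kap ^+ 2 + t ^+ 2 + r ^+ 2 ->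
  [/\ s%:C * b ord0 ord0 + t%:C * b (lift ord0 i) ord0
        + r%:C * b (lift ord0 j) ord0 = 0
    & (s ^+ 2)%:C * A ord0 ord0 + (t ^+ 2)%:C * A (lift ord0 i) (lift ord0 i)
      + (r ^+ 2)%:C * A (lift ord0 j) (lift ord0 j)
      + 2 * (s * t)%:C * A ord0 (lift ord0 i)
      + 2 * (s * r)%:C * A ord0 (lift ord0 j)
      + 2 * (t * r)%:C * A (lift ord0 i) (lift ord0 j) = 2 * f0].
Proof.
move=> rij sE; have := shell (covector_shell rij sE).
have rij' : - r * (i == j)%:R = 0 by rewrite mulNr rij oppr0.
have sE' : (- s) ^+ 2 = kap ^+ 2 + (- t) ^+ 2 + (- r) ^+ 2 by rewrite !sqrrN.
have := shell (covector_shell rij' sE').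
rewrite /symbol !sum_covector.
(* The inner sum is collapsed first, so that [sum_covector] applies again to the outer one. *)
have quad u v w : \sum_mu \sum_nu a mu nu * (covector i j u v w mu)%:C
                    * (covector i j u v w nu)%:C
  = \sum_mu (u%:C * a mu ord0 + v%:C * a mu (lift ord0 i)
             + w%:C * a mu (lift ord0 j)) * (covector i j u v w mu)%:C.
  apply: eq_bigr => mu _; rewrite -(sum_covector (a mu)) mulr_suml.
  by apply: eq_bigr => nu _; rewrite mulrAC.
rewrite !quad !(sum_covector (fun mu => _ * a mu ord0 + _ + _)).
rewrite !rmorphN !rmorphM /=.
move: s%:C t%:C r%:C.
move: (b ord0 ord0) (b (lift ord0 i) ord0) (b (lift ord0 j) ord0).
move: (a ord0 ord0) (a ord0 (lift ord0 i)) (a ord0 (lift ord0 j)).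
move: (a (lift ord0 i) ord0) (a (lift ord0 i) (lift ord0 i)).
move: (a (lift ord0 i) (lift ord0 j)).
move: (a (lift ord0 j) ord0) (a (lift ord0 j) (lift ord0 i)).
move: (a (lift ord0 j) (lift ord0 j)).
move=> ajj aj0 aji aij ai0 aii a00 a0i a0j b0 bi bj S T U E1 E2.
(* [E1] is the relation at [- K] and [E2] the one at [K]: their difference is 2i times the [b] part,
   their sum twice the quadratic part. *)
have i2 : 'i%C * 2 != 0 :> R[i].
  by rewrite mulf_neq0 ?pnatr_eq0 // eq_complex /= oner_eq0 andbF.
split.
  apply: (mulfI i2); rewrite mulr0 -[RHS](subrr f0).
  by rewrite -[X in _ = X - _]E1 -[X in _ = _ - X]E2; ring.
rewrite [RHS]mulr_natl mulr2n.
by rewrite -[X in _ = X + _]E1 -[X in _ = _ + X]E2; ring.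
Qed.

(* [Defs.minkowski] is qualified: [minkowski] is also the inequality of
   MathComp-Analysis. *)
Lemma shell_coefficients :
  [/\ forall mu, b mu ord0 = 0,
      forall mu nu,
        a mu nu + a nu mu = 2 * a ord0 ord0 * (Defs.minkowski R mu nu)%:C
    & f0 = a ord0 ord0 * (kap ^+ 2)%:C].
Proof.
(* The summand 1 is the square of one spatial component; it makes [s] positive, hence cancellable,
   even when [kap] is 0. *)
have sq t : exists2 s, 0 < s & s ^+ 2 = kap ^+ 2 + 1 + t ^+ 2.
  have p : 0 < kap ^+ 2 + 1 + t ^+ 2.
    by rewrite ltr_wpDr ?sqr_ge0 // ltr_wpDl ?sqr_ge0.
  exists (Num.sqrt (kap ^+ 2 + 1 + t ^+ 2));
    by rewrite ?sqrtr_gt0 ?sqr_sqrtr ?ltW.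
have r0 i j : 0 * (i == j)%:R = 0 :> R by rewrite mul0r.
have two0 : 2 != 0 :> R[i] by rewrite pnatr_eq0.
have [s s0 sE] := sq 0.
have sC0 : s%:C != 0.
  by rewrite -(rmorph0 (real_complex R)) (inj_eq (@complexI _)) gt_eqF.
have sE1 : s ^+ 2 = kap ^+ 2 + 1 ^+ 2 + 0 ^+ 2 by rewrite sE expr1n.
have sE2 : s ^+ 2 = kap ^+ 2 + (- 1) ^+ 2 + 0 ^+ 2 by rewrite sE sqrrN expr1n.
(* The covector [(kap, 0)] of a particle at rest isolates the time coefficient. *)
have f0E : f0 = a ord0 ord0 * (kap ^+ 2)%:C.
  have [|_] := @symbol_covector ord0 ord0 kap 0 0 (r0 _ _).
    by rewrite expr0n !addr0.
  rewrite !rmorphM rmorph0 => E; apply: (mulfI two0); rewrite -E; ring.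
(* The covectors [(s, e_i)] and [(s, - e_i)] are compared: adding the [b] relations gives
   [b ord0 ord0 = 0], subtracting the quadratic ones kills the mixed coefficient, and [f0E] then
   fixes the spatial diagonal. *)
have timespace i : [/\ b ord0 ord0 = 0, b (lift ord0 i) ord0 = 0,
    a ord0 (lift ord0 i) + a (lift ord0 i) ord0 = 0
  & a (lift ord0 i) (lift ord0 i) = - a ord0 ord0].
  have [B1 A1] := @symbol_covector i i s 1 0 (r0 _ _) sE1.
  have [B2 A2] := @symbol_covector i i s (- 1) 0 (r0 _ _) sE2.
  have b0 : b ord0 ord0 = 0.
    apply: (mulfI (mulf_neq0 two0 sC0)); rewrite mulr0 -[RHS]addr0.
    by rewrite -[X in _ = X + _]B1 -[X in _ = _ + X]B2 rmorphN; ring.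
  have A0i : a ord0 (lift ord0 i) + a (lift ord0 i) ord0 = 0.
    apply: (mulfI (mulf_neq0 (mulf_neq0 two0 two0) sC0)).
    rewrite mulr0 -[RHS](subrr (2 * f0)).
    rewrite -[X in _ = X - _]A1 -[X in _ = _ - X]A2.
    by rewrite !rmorphM !rmorphN; ring.
  split=> //.
    by move: B1; rewrite b0 rmorph0 rmorph1 mulr0 mul0r mul1r add0r addr0.
  apply/eqP; rewrite -addr_eq0; apply/eqP/(mulfI two0); rewrite mulr0.
  move: A1; rewrite sE1 f0E A0i => A1.
  rewrite -[RHS](subrr (2 * (a ord0 ord0 * (kap ^+ 2)%:C))) -[X in _ = X - _]A1.
  by rewrite !rmorphD !rmorphM !rmorph1 !rmorph0; ring.
(* At [(u, e_i + e_j)] with [u ^+ 2 = kap ^+ 2 + 2] the diagonal terms balance [f0], leaving only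
   the cross term. *)
have offdiag i j : i != j ->
    a (lift ord0 i) (lift ord0 j) + a (lift ord0 j) (lift ord0 i) = 0.
  move=> /negbTE ij.
  have [u u0 uE] := sq 1.
  have rij : 1 * (i == j)%:R = 0 :> R by rewrite ij mulr0.
  have uE1 : u ^+ 2 = kap ^+ 2 + 1 ^+ 2 + 1 ^+ 2 by rewrite uE expr1n.
  have [_] := @symbol_covector i j u 1 1 rij uE1.
  have [_ _ -> ->] := timespace i; have [_ _ -> ->] := timespace j.
  rewrite uE1 f0E => A1; apply: (mulfI two0).
  rewrite mulr0 -[RHS](subrr (2 * (a ord0 ord0 * (kap ^+ 2)%:C))).
  rewrite -[X in _ = X - _]A1.
  by rewrite !rmorphD !rmorphM !rmorph1; ring.
split=> // [mu|mu nu].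
  by case: (unliftP ord0 mu) => [i|] ->;
    [have [] := timespace i | have [] := timespace ord0].
rewrite /Defs.minkowski !mxE.
case: (unliftP ord0 mu) => [i|] ->; case: (unliftP ord0 nu) => [j|] ->.
- rewrite (inj_eq (@lift_inj _ _)) /=; have [->|ij] := eqVneq i j.
    by have [_ _ _ ->] := timespace j; rewrite mulr1n rmorphN rmorph1; ring.
  by rewrite offdiag // mulr0n rmorph0 mulr0.
- have [_ _ E _] := timespace i.
  by rewrite addrC E eq_sym /= mulr0n rmorph0 mulr0.
- by have [_ _ -> _] := timespace j; rewrite /= mulr0n rmorph0 mulr0.
- by rewrite eqxx /= mulr1n rmorph1; ring.
Qed.

End Shell.

(** * Existence of boosts *)

Section Boosts.
Variable R : realType.

(** A Householder reflection along [w = e - u] sends [e] to [u]; since [w] has squared length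
    [2 * q], its matrix has coefficient [q^-1]. The case [u = e], where [w] vanishes, is treated
    apart. *)
Lemma orthogonal_first_column n (u : 'cV[R]_n.+1) : u^T *m u = 1%:M ->
  exists2 M : 'M[R]_n.+1, M^T *m M = 1%:M & col ord0 M = u.
Proof.
move=> uu; pose e : 'cV[R]_n.+1 := delta_mx ord0 ord0.
have [->|ue] := eqVneq u e.
  exists 1%:M; first by rewrite trmx1 mul1mx.
  by apply/matrixP => i j; rewrite ord1 !mxE eqxx andbT.
have ee : e^T *m e = 1%:M.
  rewrite trmx_delta mul_delta_mx; apply/matrixP => i j.
  by rewrite !ord1 !mxE.
have eu : e^T *m u = (u ord0 ord0)%:M.
  by rewrite trmx_delta -rowE [LHS]mx11_scalar mxE.
have ue' : u^T *m e = (u ord0 ord0)%:M.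
  by rewrite -[LHS]trmxK trmx_mul trmxK eu tr_scalar_mx.
pose w := e - u; pose q := 1 - u ord0 ord0.
have wT : w^T = e^T - u^T by rewrite /w linearB.
have ww : w^T *m w = (2 * q)%:M.
  rewrite wT /w mulmxBl !mulmxBr ee eu ue' uu /q.
  by rewrite -!raddfB; congr (_%:M); ring.
(* If [q = 0], the sum of squares of the entries of [w] is zero, which forces [u = e]. *)
have q0 : q != 0.
  apply/eqP => q0; case/eqP: ue; apply/esym/eqP; rewrite -subr_eq0; apply/eqP.
  have : (w^T *m w) ord0 ord0 = 0 by rewrite ww q0 mulr0 !mxE.
  rewrite -/w mxE => /eqP; rewrite psumr_eq0 => [/allP w0|i _]; last first.
    by rewrite mxE -expr2 sqr_ge0.
  apply/matrixP => i j; rewrite ord1 [RHS]mxE; apply/eqP.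
  by have := w0 i (mem_index_enum i); rewrite mxE mulf_eq0 orbb.
(* The reflection exchanging [e] and [u]. *)
pose M := 1%:M - q^-1 *: (w *m w^T).
have MT : M^T = M by rewrite /M linearB linearZ /= trmx1 trmx_mul trmxK.
exists M.
  rewrite MT {1}/M mulmxBl mul1mx -scalemxAl {2}/M mulmxBr mulmx1 -scalemxAr.
  rewrite -mulmxA [w^T *m (_ *m _)]mulmxA ww mul_scalar_mx -!scalemxAr scalerA.
  have -> : q^-1 * (2 * q) = 2 by field.
  by rewrite scaler_nat mulr2n opprD addrA subrr sub0r scalerN opprK /M subrK.
rewrite colE -/e /M mulmxBl mul1mx -scalemxAl -mulmxA.
have -> : w^T *m e = q%:M.
  by rewrite wT mulmxBl ee ue' -raddfB.
by rewrite mul_mx_scalar scalerA mulVf // scale1r /w opprB addrC subrK.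
Qed.

(** Provides the rotation in [is_boost] that carries the x^1-direction to a given unit vector. An
    orthogonal matrix has determinant 1 or -1, and the sign can be corrected away from the first
    column. *)
Lemma SO3_first_column (u : 'cV[R]_3) : u^T *m u = 1%:M ->
  exists2 M : 'M[R]_3, SO3 M & col ord0 M = u.
Proof.
move=> /orthogonal_first_column[M MM cM].
have : \det M ^+ 2 = 1.
  by rewrite expr2 -{1}(det_tr M) -det_mulmx MM det1.
move/eqP; rewrite sqrf_eq1 => /orP[/eqP d1|/eqP dN1]; first by exists M.
(* Changing the sign of the last column makes the determinant 1. *)
pose d : 'rV[R]_3 := \row_i if i == ord_max then -1 else 1.
exists (M *m diag_mx d).
  split.
    rewrite trmx_mul mulmxA -[_ *m M^T *m M]mulmxA MM mulmx1.
    rewrite tr_diag_mx mulmx_diag.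
    rewrite -diag_const_mx; congr diag_mx; apply/rowP => i; rewrite !mxE.
    by case: ifP => _; rewrite ?mulrNN mulr1.
  rewrite det_mulmx dN1 det_diag !big_ord_recr big_ord0 /= !mxE /=.
  by rewrite !mul1r mulrNN mulr1.
by apply/colP => i; rewrite -cM mul_mx_diag !mxE mulr1.
Qed.

(** The inverse is the boost with opposite velocity, by gamma^2 (1 - beta^2) = 1. *)
Lemma boost_x1_unit (beta : R) : beta ^+ 2 < 1 -> boost_x1 beta \in unitmx.
Proof.
move=> b1.
suff /mulmx1_unit[] : boost_x1 beta *m boost_x1 (- beta) = 1%:M by [].
rewrite /boost_x1 sqrrN; set gam := (Num.sqrt _)^-1.
have g2 : gam * gam * (1 - beta ^+ 2) = 1.
  have p : 0 < 1 - beta ^+ 2 by rewrite subr_gt0.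
  by rewrite -expr2 /gam exprVn sqr_sqrtr ?ltW // mulVf ?gt_eqF.
have E1 : gam * gam - gam * beta * (gam * beta) = 1 by rewrite -[RHS]g2; ring.
apply/matrixP => i j; rewrite !mxE !big_ord_recl big_ord0 !mxE.
move: i j => [[|[|[|[|//]]]] ?] [[|[|[|[|//]]]] ?];
  rewrite /= ?mulr0 ?mul0r ?mulr1 ?mul1r ?addr0 ?add0r //;
  rewrite ?mulr1n ?mulr0n -?[RHS]E1; ring.
Qed.

(** Covariance speaks of every matrix [B] that is a boost with velocity [v]; to use it, one such
    invertible matrix must be exhibited. *)
Lemma boost_exists (c : R) (v : 'cV[R]_3) : 0 < c -> enorm v < c ->
  exists2 B : 'M[R]_4, is_boost c v B & B \in unitmx.
Proof.
move=> c0 vc.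
have sum0 : 0 <= \sum_(i < 3) v i ord0 ^+ 2.
  by apply: sumr_ge0 => i _; exact: sqr_ge0.
have [M sM vM] : exists2 M : 'M[R]_3, SO3 M & v = enorm v *: col ord0 M.
  (* A zero velocity has no direction, and the identity rotation is taken. *)
  have [v0|v0] := eqVneq (enorm v) 0.
    exists 1%:M; first by split; rewrite ?trmx1 ?mul1mx ?det1.
    rewrite v0 scale0r; apply/colP => i; rewrite [RHS]mxE.
    move/eqP: v0; rewrite sqrtr_eq0 => s0.
    have /eqP : \sum_(i < 3) v i ord0 ^+ 2 = 0 by apply/le_anti; rewrite s0.
    rewrite psumr_eq0 => [/allP/(_ i (mem_index_enum i))|j _]; last first.
      exact: sqr_ge0.
    by rewrite sqrf_eq0 => /eqP.
  have [|M sM cM] := @SO3_first_column ((enorm v)^-1 *: v).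
    rewrite [(_ *: _)^T]linearZ /= -scalemxAl -scalemxAr scalerA.
    rewrite [v^T *m v]mx11_scalar mxE.
    rewrite (eq_bigr (fun i => v i ord0 ^+ 2)) => [|i _]; last first.
      by rewrite mxE expr2.
    rewrite -[X in X%:M]sqr_sqrtr // -/(enorm v) scale_scalar_mx; congr (_%:M).
    by field.
  by exists M => //; rewrite cM scalerA mulfV // scale1r.
exists (rot4 M *m boost_x1 (enorm v / c) *m invmx (rot4 M)); first by exists M.
have [_ dM] := sM.
have uM : rot4 M \in unitmx.
  rewrite unitmxE; have -> : \det (rot4 M) = \det (1%:M : 'M[R]_1) * \det M.
    exact: (@det_ublock R 1 3 1%:M 0 M).
  by rewrite det1 dM mulr1 unitr1.
have ub : boost_x1 (enorm v / c) \in unitmx.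
  apply: boost_x1_unit; rewrite expr_lt1 //.
    by rewrite ltr_pdivrMr // mul1r.
  by rewrite divr_ge0 ?sqrtr_ge0 // ltW.
by rewrite !unitmx_mul uM ub unitmx_inv uM.
Qed.

End Boosts.

(** * The wave equation and its boost factors *)

Section WaveEquation.
Variable R : realType.
Implicit Types (a : 'M[R[i]]_4) (b : 'cV[R[i]]_4) (f g : 'cV[R]_4 -> R[i]).
Implicit Types (G Psi : 'cV[R]_4 -> R[i]) (x y : 'cV[R]_4) (mu nu rho : 'I_4).

(** The phase is k.r - (omega/c) x^0, whence the frequency [- (c * K ord0)]. *)
Lemma plane_waveE (c : R) (K : 'I_4 -> R) : 0 < c ->
  plane_wave c (\col_i K (lift ord0 i)) (- (c * K ord0))
  = (fun y => expi (phase K y)).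
Proof.
move=> c0; apply/funext => y.
rewrite /plane_wave /phase [in RHS]big_ord_recl /=.
under eq_bigr do rewrite mxE.
have -> : - (c * K ord0) * (y ord0 ord0 / c) = - (K ord0 * y ord0 ord0).
  by field; rewrite gt_eqF.
by rewrite opprK [X in _ = expi X]addrC.
Qed.

(** The exponential never vanishes and can be cancelled from the equation; the condition on [K] is
    the energy-momentum relation divided by c^2 hbar^2. *)
Lemma symbol_on_shell (m hbar c : R) a b f : 0 < hbar -> 0 < c ->
  (forall (k : 'cV[R]_3) (omega : R),
     hbar ^+ 2 * omega ^+ 2
       = m ^+ 2 * c ^+ 4 + c ^+ 2 * hbar ^+ 2 * enorm k ^+ 2 ->
     forall x, wave_op a b f (plane_wave c k omega) x = 0) ->
  forall x (K : 'I_4 -> R),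
    K ord0 ^+ 2 = (m * c / hbar) ^+ 2 + \sum_(i < 3) K (lift ord0 i) ^+ 2 ->
    symbol a b K = f x.
Proof.
move=> h0 c0 sol x K shellK.
have := sol (\col_i K (lift ord0 i)) (- (c * K ord0)) _ x.
rewrite plane_waveE // wave_op_expi => /(_ _)/eqP.
rewrite mulf_eq0 (negbTE (expi_neq0 _)) orbF subr_eq0 => eqf.
apply/esym/eqP/eqf; rewrite /enorm sqr_sqrtr; last first.
  by apply: sumr_ge0 => i _; exact: sqr_ge0.
under eq_bigr do rewrite mxE.
move: (\sum_(i < 3) _) shellK => k2 shellK.
rewrite sqrrN exprMn shellK; field.
by rewrite gt_eqF.
Qed.

(** * Operators whose second-order part is a multiple of the Minkowski metric *)

Section Coefficients.
Variables (a : 'M[R[i]]_4) (b : 'cV[R[i]]_4) (lambda : R[i]).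
Hypothesis b0 : forall mu, b mu ord0 = 0.
Hypothesis aS : forall mu nu,
  a mu nu + a nu mu = 2 * lambda * (Defs.minkowski R mu nu)%:C.

Lemma wave_op_second_order f Psi x : wave_op a b f Psi x
  = \sum_mu \sum_nu a mu nu * partial mu (partial nu Psi) x + f x * Psi x.
Proof.
rewrite /wave_op [X in _ + X + _]big1 ?addr0 // => mu _.
by rewrite b0 mul0r.
Qed.

(** Doubling the sum and exchanging the indices in one copy leaves [a mu nu + a nu mu], because
    partial derivatives commute. *)
Lemma wave_op_dalembertian f Psi x : smooth Psi ->
  wave_op a b f Psi x = lambda * dalembertian Psi x + f x * Psi x.
Proof.
move=> sPsi; rewrite wave_op_second_order; congr (_ + _).
have two0 : 2 != 0 :> R[i] by rewrite pnatr_eq0.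
apply: (mulfI two0); rewrite mulr_natl mulr2n {2}exchange_big /=.
rewrite -big_split /= /dalembertian !mulr_sumr; apply: eq_bigr => mu _.
rewrite -big_split !mulr_sumr; apply: eq_bigr => nu _ /=.
by rewrite (partial_swap nu mu) // -mulrDl aS !mulrA.
Qed.

(** Leibniz rule for multiplication by a coordinate, whose own second derivatives vanish. The [+ 0]
    matches [affine] with [d = 0]. *)
Lemma wave_op_mul_coord f G rho x :
  cdifferentiable G -> (forall mu, cdifferentiable (partial mu G)) ->
  wave_op a b f (fun y => G y * (y rho ord0 + 0)%:C) x
  = wave_op a b f G x * (x rho ord0)%:C
    + 2 * lambda * (Defs.minkowski R rho rho)%:C * partial rho G x.
Proof.
move=> dG ddG.
have dc := @differentiable_coordD R rho 0.
have d1 nu : partial nu (fun y => G y * (y rho ord0 + 0)%:C)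
    = (fun y => partial nu G y * (y rho ord0 + 0)%:C + (nu == rho)%:R * G y).
  apply/funext => y; rewrite partialMr // derive_coordD mxE eqxx andbT.
  by rewrite rmorph_nat eq_sym [G y * _]mulrC.
have d2 mu nu : partial mu (partial nu (fun y => G y * (y rho ord0 + 0)%:C)) x
    = partial mu (partial nu G) x * (x rho ord0)%:C
      + ((mu == rho)%:R * partial nu G x + (nu == rho)%:R * partial mu G x).
  rewrite d1 partialD; last 2 first.
  - exact: cdifferentiableMr.
  - exact: cdifferentiableZ.
  rewrite partialMr // partialZ // derive_coordD mxE eqxx andbT addr0.
  by rewrite rmorph_nat eq_sym [partial nu G x * _]mulrC addrA.
have pick (F : 'I_4 -> R[i]) : \sum_nu F nu * (nu == rho)%:R = F rho.
  rewrite (bigD1 rho) //= eqxx mulr1 big1 ?addr0 // => nu /negbTE ->.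
  by rewrite mulr0.
(* The two first-order sums combine into the symmetric part of [a], and the diagonal metric selects
   the index [rho]. *)
have cross : \sum_nu a rho nu * partial nu G x
      + \sum_mu a mu rho * partial mu G x
    = 2 * lambda * (Defs.minkowski R rho rho)%:C * partial rho G x.
  rewrite -big_split (bigD1 rho) //= big1 ?addr0 => [|mu mr].
    by rewrite -mulrDl aS.
  rewrite -mulrDl aS /Defs.minkowski !mxE [rho == mu]eq_sym (negbTE mr).
  by rewrite mulr0n rmorph0 mulr0 mul0r.
have second : \sum_mu \sum_nu
    a mu nu * partial mu (partial nu (fun y => G y * (y rho ord0 + 0)%:C)) x
  = (\sum_mu \sum_nu a mu nu * partial mu (partial nu G) x) * (x rho ord0)%:C
    + 2 * lambda * (Defs.minkowski R rho rho)%:C * partial rho G x.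
  rewrite -cross -(pick (fun mu => \sum_nu a mu nu * partial nu G x)).
  rewrite mulr_suml -!big_split; apply: eq_bigr => mu _ /=.
  rewrite -(pick (fun nu => a mu nu * partial mu G x)).
  rewrite !mulr_suml -!big_split; apply: eq_bigr => nu _ /=.
  by rewrite d2; ring.
have x0 : (x rho ord0 + 0)%:C = (x rho ord0)%:C by rewrite addr0.
rewrite [LHS]wave_op_second_order second x0 wave_op_second_order.
by rewrite [LHS]addrAC [f x * (_ * _)]mulrA -[in LHS]mulrDl.
Qed.

Hypothesis lambda0 : lambda != 0.

(* Testing covariance on Psi' = 1 and on the linear functions Psi' = x^rho
   isolates the commutator [L, x^rho] = 2 lambda eta^{rho rho} d_rho applied to
   the pulled-back factor; the Lorentz invariance of the d'Alembertian is not
   needed. *)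
Lemma covariance_factor_constant f (T : 'M[R]_4) g : T \in unitmx ->
  smooth g -> covariant_under a b f T g -> forall x y, g x = g y.
Proof.
move=> uT sg [h [_ cov]].
(* The factor in unprimed variables, that is, the transform of the constant function 1. *)
pose G y := g (invmx T *m y).
have dG : cdifferentiable G.
  exact/cdifferentiable_comp_mulmx/smooth_cdifferentiable.
have ddG mu : cdifferentiable (partial mu G).
  exact: cdifferentiable_partial_comp_mulmx.
have lhs1 x : wave_op a b f G x = h (invmx T *m x) * f x.
  have := cov _ (smooth_affine ord0 0 1) (invmx T *m x).
  rewrite mulKVmx //.
  have -> : (fun y => g (invmx T *m y) * affine ord0 0 1 (invmx T *m y)) = G.
    by apply/funext => y; rewrite /affine mul0mx mxE add0r rmorph1 mulr1.
  move=> ->; congr (_ * _).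
  rewrite wave_op_second_order big1 => [|mu _]; last first.
    rewrite big1 // => nu _; rewrite !partial_affine /affine mul0mx !mxE add0r.
    by rewrite rmorph0 mulr0.
  by rewrite add0r mulKVmx // /affine mul0mx mxE add0r rmorph1 mulr1.
(* The test function is x^rho expressed in primed variables, so that after transformation it is the
   plain coordinate times [G]. *)
have lhs2 rho x : wave_op a b f (fun y => G y * (y rho ord0 + 0)%:C) x
    = h (invmx T *m x) * (f x * (x rho ord0)%:C).
  have := cov _ (smooth_affine rho T 0) (invmx T *m x).
  rewrite mulKVmx //.
  have -> : (fun y => g (invmx T *m y) * affine rho T 0 (invmx T *m y))
          = (fun y => G y * (y rho ord0 + 0)%:C).
    by apply/funext => y; rewrite /affine mulKVmx.
  move=> ->; congr (_ * _).
  rewrite wave_op_second_order big1 => [|mu _]; last first.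
    rewrite big1 // => nu _; rewrite !partial_affine /affine mul0mx !mxE add0r.
    by rewrite rmorph0 mulr0.
  by rewrite add0r mulKVmx // /affine mulKVmx // addr0.
(* Subtracting x^rho times [lhs1] from [lhs2] leaves a nonzero multiple of the derivative of [G]. *)
have G0 rho x : partial rho G x = 0.
  have := lhs2 rho x; rewrite wave_op_mul_coord // lhs1 mulrA -[RHS]addr0.
  move=> /addrI/eqP; rewrite -mulrA mulf_eq0 mulf_eq0 (negbTE lambda0).
  rewrite pnatr_eq0 /= mulf_eq0 => /orP[|/eqP //].
  rewrite /Defs.minkowski !mxE eqxx mulr1n.
  by case: ifP => _; rewrite ?rmorphN rmorph1 ?oppr_eq0 oner_eq0.
move=> x y; have := cdifferentiable_partial0_constant dG G0 (T *m x) (T *m y).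
by rewrite /G !mulKmx.
Qed.

End Coefficients.
End WaveEquation.

Theorem theorem5 (R : realType) (m hbar c : R)
    (a : 'M[R[i]]_4) (b : 'cV[R[i]]_4) (f : 'cV[R]_4 -> R[i])
    (g : 'cV[R]_3 -> 'cV[R]_4 -> R[i]) :
  0 <= m -> 0 < hbar -> 0 < c ->
  involves_time_derivatives a b ->
  lorentz_covariant c a b f g ->
  (forall (k : 'cV[R]_3) (omega : R),
     hbar ^+ 2 * omega ^+ 2
       = m ^+ 2 * c ^+ 4 + c ^+ 2 * hbar ^+ 2 * enorm k ^+ 2 ->
     forall x, wave_op a b f (plane_wave c k omega) x = 0) ->
  (exists2 lambda : R[i], lambda != 0 &
     forall Psi : 'cV[R]_4 -> R[i], smooth Psi ->
     forall x, wave_op a b f Psi x = lambda * klein_gordon_op m c hbar Psi x) /\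
  (forall v : 'cV[R]_3, enorm v < c ->
     exists2 kappa : R[i], kappa != 0 & forall x', g v x' = kappa).
Proof.
move=> _ hbar0 c0 time [_ cov] sol.
have shell := symbol_on_shell hbar0 c0 sol.
(* [a] and [b] are constant, so one point suffices for them; [f] is then read off at each point. *)
have [b0 aS _] := shell_coefficients (shell 0).
have fE x : f x = a ord0 ord0 * ((m * c / hbar) ^+ 2)%:C.
  by have [] := shell_coefficients (shell x).
(* Otherwise [aS] makes the symmetric part of [a] vanish along with [b], and no time derivative
   would be left. *)
have lambda0 : a ord0 ord0 != 0.
  apply/eqP => a00; case: time => [[nu]|]; last by rewrite b0 eqxx.
  by rewrite aS a00 mulr0 mul0r eqxx.
split=> [|v vc].
  exists (a ord0 ord0) => // Psi sPsi x.
  rewrite (wave_op_dalembertian b0 aS) // fE /klein_gordon_op mulrDr mulrA.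
  by rewrite expr_div_n exprMn.
have [sg g0 covB] := cov v vc.
have [B isB uB] := boost_exists c0 vc.
exists (g v 0); first exact: g0.
move=> x'.
exact: (covariance_factor_constant b0 aS lambda0 uB sg (covB B isB)).
Qed.
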